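(* Let $n\ge 0$ be an integer, let $V=\mathbb{R}^n$ be endowed with the sup-norm $\|(x^1,\dots,x^n)\|=\max_i|x^i|$, and let $X\subseteq V$ be a non-empty subset, with the metric induced from $V$, such that $d_{\mathrm{H}}(X,V)<\infty$. Then $d_{\mathrm{GH}}(X,V)=d_{\mathrm{H}}(X,V)$.
   Context: For non-empty subsets $A,A'$ of a metric space $Z$ with distance $|xy|$ between points $x,y$, write $|xA|=\inf_{a\in A}|xa|$. The Hausdorff distance is $d_{\mathrm{H}}(A,A')=\max\{\sup_{a\in A}|aA'|,\ \sup_{a'\in A'}|a'A|\}\in[0,\infty]$. For non-empty metric spaces $X,Y$, the Gromov--Hausdorff distance $d_{\mathrm{GH}}(X,Y)\in[0,\infty]$ is the infimum of $d_{\mathrm{H}}(X',Y')$ over all metric spaces $Z$ and all subsets $X',Y'\subseteq Z$ isometric to $X$ and $Y$ respectively. Equivalently, $d_{\mathrm{GH}}(X,Y)=\frac12\inf_R\operatorname{dis}R$, where $R$ ranges over all correspondences (subsets $R\subseteq X\times Y$ projecting onto both $X$ and $Y$) and $\operatorname{dis}R=\sup\{||xx'|-|yy'||:(x,y),(x',y')\in R\}$. *)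

(* Defs.v *)
From HB Require Import structures.
From mathcomp Require Import all_boot all_order all_algebra.
From mathcomp Require Import all_classical all_reals all_analysis.

Set Implicit Arguments.
Unset Strict Implicit.
Unset Printing Implicit Defensive.

Import Order.TTheory GRing.Theory Num.Theory.
Import numFieldNormedType.Exports.

Local Open Scope classical_set_scope.
Local Open Scope ring_scope.

                                                                              
Section rV_metric.
Context (K : numFieldType) (n : nat).

Let dist (x y : 'rV[K]_n) : K := `|x - y|.

Let dist_ge0 x y : 0 <= dist x y.
Proof. exact: normr_ge0. Qed.

Let dist_positivity x y : dist x y = 0 -> x = y.
Proof. by move=> /normr0_eq0/eqP; rewrite subr_eq0 => /eqP. Qed.

Let ballEdist x d : ball x d = [set y | dist x y < d].
Proof. by rewrite mx_norm_ball. Qed.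

HB.instance Definition _ :=
  @PseudoMetric_isMetric.Build K 'rV[K]_n
    dist dist_ge0 dist_positivity ballEdist.

End rV_metric.

Lemma mdist_rVE (R : realType) (n : nat) (x y : 'rV[R]_n) :
  mdist x y = \big[Num.max/0]_(i < n) `|x ord0 i - y ord0 i|.
Proof.
rewrite /mdist/= [LHS]mx_normrE.
apply/eqP; rewrite eq_le; apply/andP; split.
  apply/bigmax_leP; split=> [|[i j] _ /=]; first exact: bigmax_ge_id.
  by rewrite (ord1 i) !mxE; apply: (le_bigmax _ (fun j => `|x ord0 j - y ord0 j|)).
apply/bigmax_leP; split=> [|j _]; first exact: bigmax_ge_id.
apply: le_trans (le_bigmax _ (fun ij => `|(x - y) ij.1 ij.2|) (ord0, j)).
by rewrite !mxE.
Qed.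

                                                                             
                            
Section set_type_metric.
Context (R : realType) (M : metricType R) (A : set M).

Let dist (x y : A) : R := mdist (set_val x) (set_val y).

Let dist_ge0 x y : 0 <= dist x y.
Proof. exact: mdist_ge0. Qed.

Let dist_positivity x y : dist x y = 0 -> x = y.
Proof. by move=> /mdist_positivity/val_inj. Qed.

Let ballEdist x d : ball x d = [set y | dist x y < d].
Proof. by rewrite -initial_ballE ballEmdist. Qed.

HB.instance Definition _ :=
  @PseudoMetric_isMetric.Build R (set_type A)
    dist dist_ge0 dist_positivity ballEdist.

End set_type_metric.

Local Open Scope ereal_scope.

                                                                               
                                                                
Definition set_dist (R : realType) (Z : metricType R) (x : Z) (A : set Z)
  : \bar R :=
  ereal_inf [set (mdist x a)%:E | a in A].

Definition hausdorff_dist (R : realType) (Z : metricType R) (A B : set Z)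
  : \bar R :=
  maxe (ereal_sup [set set_dist a B | a in A])
       (ereal_sup [set set_dist b A | b in B]).

Definition isometric_to_subset (R : realType) (X Z : metricType R)
    (A : set Z) : Prop :=
  exists f : X -> Z, (forall x y, mdist (f x) (f y) = mdist x y) /\
                     range f = A.

Definition gromov_hausdorff_dist (R : realType) (X Y : metricType R)
  : \bar R :=
  ereal_inf [set r | exists (Z : metricType R) (X' Y' : set Z),
    [/\ isometric_to_subset X X', isometric_to_subset Y Y' &
        r = hausdorff_dist X' Y']].

(* Main.v *)
Require Import Defs.
From mathcomp Require Import all_boot all_order all_algebra.
From mathcomp Require Import all_classical all_reals all_analysis.
From mathcomp Require Import ring lra.

(** Write V for R^n with the sup-norm.  Taking Z = V in the definition shows
that the Gromov-Hausdorff distance is at most the Hausdorff distance.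

For the other inequality let f : X -> Z and g : V -> Z be isometric embeddings
whose images are at Hausdorff distance less than r.  Every 1-Lipschitz map from
a subset of a metric space to V extends to the whole space: McShane's formula
does this for each coordinate ([nonexpansive_extension]).  Hence there is a
1-Lipschitz h : Z -> V with h (f x) = x on X.  Each point g v is within r of
f x for some x in X, so h (g v) is within r of X; it remains to see that
h \o g : V -> V has dense image.

As X is at finite Hausdorff distance from V, a coarse inverse G : V -> V of
h \o g exists: retract Z onto g V, apply this to f X, and extend from X to V.
The map H = h \o g \o G is 1-Lipschitz and moves points by a bounded amount, so
topologically it has degree one and must be onto.  This is where
Brouwer's theorem enters, in the form of a combinatorial Poincare-Miranda
theorem ([cubical_poincare_miranda]): if boolean functions u_1, ..., u_n on the
grid {0, ..., m+1}^n are such that u_i is false on the face x_i = 0 and true on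
the face x_i = m+1, then on some unit cube none of the u_i is constant.
Applied to u_i = (p_i <= H_i) on a fine grid around p, it gives a point whose
image is as close to p as desired, because H is 1-Lipschitz.

The combinatorial theorem is proved with cubical cochains modulo 2 on the
discrete torus obtained from the grid by joining each face x_i = m+1 back to the
face x_i = 0.  The product of the
1-cochains d u_i + seam_i, where seam_i is the indicator of the edges that leave
x_i = m+1 in direction i, differs from the product of the seam_i by a
coboundary ([cup_prod_cohomologous]).  The sum of a coboundary over the torus
vanishes, and the product of the seams is nonzero on exactly one cube, so the
first product is nonzero on some cube.  On that cube each factor is nonzero on
some edge; the hypothesis on faces keeps the cube away from the seams, and there
the i-th factor is d u_i. *)

Set Implicit Arguments.
Unset Strict Implicit.
Unset Printing Implicit Defensive.

Import Order.TTheory GRing.Theory Num.Theory.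
Import numFieldNormedType.Exports.

Local Open Scope ring_scope.

(** * Cubical cochains modulo 2 on the discrete torus *)

Section Cochains.
Variables n m : nat.
Implicit Types (S : {set 'I_n}) (x y : 'rV['I_m.+2]_n).

Let vertex : Type := 'rV['I_m.+2]_n.
(** The value of a cochain at [S] and [x] is its value on the cube with lowest
vertex [x] and edges in the directions of [S].  All degrees are bundled
together. *)
Let cochain : Type := {set 'I_n} -> vertex -> 'F_2.
Let cochain1 : Type := vertex -> 'I_n -> 'F_2.

Definition unit_step (j : 'I_n) : 'rV['I_m.+2]_n := delta_mx 0 j.
Local Notation "x `+ j" := (x + unit_step j) (at level 50, left associativity).

Definition coboundary (w : cochain) : cochain := fun S x =>
  \sum_(j in S) (w (S :\ j) (x `+ j) + w (S :\ j) x).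

(** Serre's cup product with a 1-cochain on the left: [b] is evaluated on the edge
in direction [l] leaving [x], and [w] on the face orthogonal to that edge at its
far end. *)
Definition cup (b : cochain1) (w : cochain) : cochain := fun S x =>
  \sum_(l in S) b x l * w (S :\ l) (x `+ l).

Definition cup_unit : cochain := fun S _ => (S == finset.set0)%:R.

Definition cup_prod (bs : seq cochain1) : cochain := foldr cup cup_unit bs.

Definition closed1 (b : cochain1) := forall x j l,
  b x j + b (x `+ j) l + (b x l + b (x `+ l) j) = 0.

Lemma addF2 (a : 'F_2) : a + a = 0.
Proof. exact/addrr_pchar2/pchar_Fp. Qed.

Lemma addF2_eq0 (a b : 'F_2) : a + b = 0 -> a = b.
Proof. by move=> ab0; rewrite -[LHS]addr0 -(addF2 b) addrA ab0 add0r. Qed.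

Lemma sum_distinct_swap S (F : 'I_n -> 'I_n -> 'F_2) :
  \sum_(j in S) \sum_(l in S :\ j) F j l =
  \sum_(j in S) \sum_(l in S :\ j) F l j.
Proof.
rewrite (exchange_big_dep (mem S)) /=; last by move=> j l _; rewrite !inE => /andP[].
apply: eq_bigr => l lS; apply: eq_bigl => j; rewrite !inE lS andbT eq_sym.
by rewrite andbC.
Qed.

(** The terms at (j, l) and (l, j) cancel modulo 2. *)
Lemma sum_distinct_sym S (F : 'I_n -> 'I_n -> 'F_2) :
  (forall j l, F j l = F l j) -> \sum_(j in S) \sum_(l in S :\ j) F j l = 0.
Proof.
move=> symF.
have split_lt j : \sum_(l in S :\ j) F j l =
    \sum_(l in S | (j < l)%N) F j l + \sum_(l in S | (l < j)%N) F j l.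
  rewrite (bigID (fun l : 'I_n => j < l)%N) /=; congr (_ + _); apply: eq_bigl => l;
    by rewrite !inE -val_eqE /=; case: ltngtP; rewrite ?andbT ?andbF.
rewrite (eq_bigr _ (fun j _ => split_lt j)) big_split /=.
rewrite [X in _ + X](exchange_big_dep (mem S)) /=; last by move=> j l _ /andP[].
under [X in _ + X]eq_bigr => l lS.
  under eq_bigr do rewrite symF.
  rewrite (eq_bigl (fun j => (j \in S) && (l < j)%N)); last by move=> j; rewrite lS.
  over.
exact: addF2.
Qed.

(** The Leibniz rule when the derivative of [b] is zero.  The two sides differ by
the sum over distinct j, l of (b (x + j) l + b x l) * w (x + j + l); closedness of
[b] says that the first factor is symmetric in j and l. *)
Lemma coboundary_cup b w S x : closed1 b ->
  coboundary (cup b w) S x = cup b (coboundary w) S x.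
Proof.
move=> closed_b.
have wC j l : S :\ j :\ l = S :\ l :\ j by rewrite !finset.setDDl finset.setUC.
have xC j l : x `+ j `+ l = x `+ l `+ j by rewrite addrAC.
pose v j l := w (S :\ j :\ l) (x `+ j `+ l).
pose G j l := b x l * (v j l + w (S :\ j :\ l) (x `+ l)).
pose D j l := (b (x `+ j) l + b x l) * v j l.
transitivity (\sum_(j in S) \sum_(l in S :\ j) (G j l + D j l)).
  apply: eq_bigr => j jS; rewrite -big_split /=; apply: eq_bigr => l lS.
  rewrite /G /D mulrDr mulrDl [_ + b x l * v j l]addrC addrACA addF2 add0r.
  by rewrite addrC.
under eq_bigr do rewrite big_split /=.
rewrite big_split /= [X in _ + X]sum_distinct_sym ?addr0.
  rewrite sum_distinct_swap; apply: eq_bigr => l lS.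
  rewrite big_distrr /=; apply: eq_bigr => j jS.
  by rewrite /G /v wC xC.
move=> j l; rewrite /D /v wC xC; congr (_ * _); apply: addF2_eq0.
by rewrite -(closed_b x j l); ring.
Qed.

Lemma coboundary_cup_prod (I : Type) (s : seq I) (b : I -> cochain1) S x :
  (forall i, closed1 (b i)) -> coboundary (cup_prod [seq b i | i <- s]) S x = 0.
Proof.
move=> closed_b; elim: s S x => [|i s IH] S x /=.
  by apply: big1 => j _; rewrite addF2.
by rewrite coboundary_cup //; apply: big1 => l _; rewrite IH mulr0.
Qed.

Definition d0 (f : vertex -> 'F_2) : cochain1 := fun x j => f (x `+ j) + f x.

Lemma closed1_d0 f : closed1 (d0 f).
Proof.
move=> x j l; rewrite /d0 [x `+ l `+ j]addrAC.
rewrite -[RHS](addF2 (f (x `+ j) + f x + f (x `+ l) + f (x `+ j `+ l))); ring.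
Qed.

Lemma closed1D b c : closed1 b -> closed1 c ->
  closed1 (fun x j => b x j + c x j).
Proof.
by move=> closed_b closed_c x j l;
  rewrite -[RHS](addr0 0) -{1}(closed_b x j l) -(closed_c x j l); ring.
Qed.

(** The Leibniz rule for the product of the 0-cochain [f] and [w]. *)
Lemma cup_d0 f w S x :
  coboundary (fun S x => f x * w S x) S x =
  cup (d0 f) w S x + f x * coboundary w S x.
Proof.
rewrite /coboundary /cup big_distrr -big_split /=; apply: eq_bigr => j jS.
rewrite /d0; rewrite -[LHS]addr0 -(addF2 (f x * w (S :\ j) (x `+ j))); ring.
Qed.

(** Translation by a unit step permutes the torus, so each term of the coboundary
is summed twice. *)
Lemma sum_coboundary w S : \sum_x coboundary w S x = 0.
Proof.
rewrite exchange_big /= big1 // => j jS; rewrite big_split /=.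
by rewrite -(reindex_inj (addIr (unit_step j)) (P := xpredT) (F := w (S :\ j))) addF2.
Qed.

Definition cohomologous1 b c := exists f, forall x j, b x j = c x j + d0 f x j.

(** The cohomology class of a product depends only on the classes of its closed
factors.  For b = c + d f and products w, v of the remaining factors with
w = v + d e, the product of b and w exceeds that of c and v by
(d f) w + c (d e) = d (f w + c e), since w and c are closed. *)
Lemma cup_prod_cohomologous (I : eqType) (s : seq I) (b c : I -> cochain1) :
    (forall i, closed1 (b i)) -> (forall i, closed1 (c i)) ->
    (forall i, cohomologous1 (b i) (c i)) ->
  exists e, forall S x, cup_prod [seq b i | i <- s] S x =
    cup_prod [seq c i | i <- s] S x + coboundary e S x.
Proof.
move=> closed_b closed_c bc; elim: s => [|i s [e he]].
  by exists (fun _ _ => 0) => S x /=; rewrite /coboundary big1 ?addr0.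
have [f hf] := bc i.
exists (fun S x => f x * cup_prod [seq b i | i <- s] S x + cup (c i) e S x).
move=> S x; set w := cup_prod [seq b i | i <- s].
have -> : coboundary (fun S x => f x * w S x + cup (c i) e S x) S x =
    coboundary (fun S x => f x * w S x) S x + coboundary (cup (c i) e) S x.
  by rewrite -big_split; apply: eq_bigr => j jS /=; rewrite addrACA.
rewrite cup_d0 coboundary_cup // coboundary_cup_prod // mulr0 addr0 /=.
rewrite [cup (d0 f) _ S x + _]addrC addrA /cup -!big_split.
apply: eq_bigr => l lS /=; rewrite -/w hf mulrDl; congr (_ + _).
by rewrite -mulrDr -he.
Qed.

(** Dual to the hyperplane along which the torus is cut open: this cochain counts
crossings from the last layer in direction [i] back to the first. *)
Definition seam (i : 'I_n) : cochain1 := fun x l =>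
  ((l == i) && (x 0 i == ord_max))%:R.

Lemma unit_stepE x i j : (x `+ j) 0 i = x 0 i + (i == j)%:R.
Proof. by rewrite !mxE eqxx. Qed.

Lemma closed1_seam i : closed1 (seam i).
Proof.
move=> x j l; rewrite /seam !unit_stepE.
case: (eqVneq j i) => _; case: (eqVneq l i) => _;
  by rewrite /= ?addr0 ?add0r ?addF2.
Qed.

(** The first seam can only be crossed in its own direction, and stepping in that
direction leaves the other coordinates unchanged. *)
Lemma cup_prod_seam (s : seq 'I_n) S x : uniq s ->
  cup_prod [seq seam i | i <- s] S x =
  ((S == [set:: s]) && all (fun i => x 0 i == ord_max) s)%:R.
Proof.
elim: s S x => [|i s IH] S x /=.
  by rewrite andbT (_ : [set:: [::]] = finset.set0) //; apply/finset.setP => i; rewrite !inE.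
move=> /andP[nis us]; rewrite /cup.
have [iS|niS] := boolP (i \in S); last first.
  rewrite big1 => [|l lS]; last first.
    by rewrite /seam; case: eqP lS niS => [->->|_ _ _] //=; rewrite mul0r.
  case: eqP niS => // ->; by rewrite !inE eqxx.
rewrite (bigD1 i) //= big1 ?addr0 => [|l /andP[_ /negPf li]]; last first.
  by rewrite /seam li mul0r.
rewrite IH // /seam eqxx /= -natrM mulnb; congr (_%:R); congr nat_of_bool.
have -> : all (fun j => (x `+ i) 0 j == ord_max) s = all (fun j => x 0 j == ord_max) s.
  apply: eq_in_all => j js; rewrite unit_stepE; have [ji|_] := eqVneq j i; last by rewrite addr0.
  by rewrite -ji js in nis.
rewrite andbCA; congr (_ && _); apply/eqP/eqP => [eS|->].
  by rewrite -(finset.setD1K iS) eS; apply/finset.setP => j; rewrite !inE.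
apply/finset.setP => j; rewrite !inE; case: eqP => //= ->; by rewrite (negPf nis).
Qed.

Lemma sum_cup_prod_seam :
  \sum_x cup_prod [seq seam i | i <- enum 'I_n] [set: 'I_n] x = 1.
Proof.
rewrite (bigD1 (const_mx ord_max)) //= big1 ?addr0 => [|x nx].
  rewrite cup_prod_seam ?enum_uniq // (_ : _ && _) //.
  apply/andP; split; first by apply/eqP/finset.setP => i; rewrite !inE mem_enum.
  by apply/allP => i _; rewrite mxE.
rewrite cup_prod_seam ?enum_uniq // (_ : _ && _ = false) //.
apply: contraNF nx => /andP[_ /allP nx]; apply/eqP/matrixP => i j.
by rewrite mxE ord1; apply/eqP/nx; rewrite mem_enum.
Qed.

(** A nonzero value on the cube at [x] is witnessed by a monotone path through
the cube, on each edge of which the corresponding factor is nonzero. *)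
Lemma cup_prod_neq0 (I : eqType) (s : seq I) (b : I -> cochain1) S x i :
    cup_prod [seq b i | i <- s] S x != 0 -> i \in s ->
  exists (A : {set 'I_n}) l,
    l \notin A /\ b i (x + \sum_(j in A) unit_step j) l != 0.
Proof.
move=> nz si.
suff [A [l [_ /finset.setDP[_ ?] ?]]] : exists (A : {set 'I_n}) l, [/\ A \subset S,
    l \in S :\: A & b i (x + \sum_(j in A) unit_step j) l != 0] by exists A, l.
elim: s S x nz si => //= k s IH S x nz.
have [l /andP[lS]] : exists l, (l \in S) &&
    (b k x l * cup_prod [seq b i | i <- s] (S :\ l) (x `+ l) != 0).
  apply/existsP; apply: contra_neqT nz => /existsPn nz; apply: big1 => l lS.
  by have := nz l; rewrite lS /= => /negPn/eqP.
rewrite mulf_eq0 negb_or inE => /andP[bkl nz'] /orP[/eqP->|si].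
  by exists finset.set0, l; rewrite big_set0 addr0 finset.sub0set !inE.
have [A [l' [AS l'A bi]]] := IH _ _ nz' si.
have lA : l \notin A by apply/negP => /(fintype.subsetP AS); rewrite !inE eqxx.
exists (l |: A), l'; split.
- by rewrite finset.subUset finset.sub1set lS (fintype.subset_trans AS) // finset.subsetDl.
- by move: l'A; rewrite !inE negb_or => /and3P[-> -> ->].
- by rewrite big_setU1 //= addrA.
Qed.

Lemma sum_unit_step (A : {set 'I_n}) i :
  (\sum_(j in A) unit_step j) 0 i = (i \in A)%:R.
Proof.
rewrite summxE; have [iA|niA] := boolP (i \in A).
  rewrite (bigD1 i) //= mxE !eqxx big1 ?addr0 // => j /andP[_ /negPf ji].
  by rewrite mxE eqxx eq_sym ji.
rewrite big1 // => j jA; rewrite mxE eqxx /=; case: eqP => // ij.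
by rewrite ij jA in niA.
Qed.

End Cochains.

(** * The Poincare-Miranda theorem on a grid *)

Definition in_cube n m (x y : 'rV['I_m.+2]_n) :=
  forall j, (x 0%R j <= y 0%R j <= (x 0%R j).+1)%N.

(** A combinatorial form of Brouwer's theorem: the [u i] may be thought of as
the signs of the coordinates of a map that pushes opposite faces of the grid to
opposite sides, and the conclusion locates an approximate zero. *)
Lemma cubical_poincare_miranda n m (u : 'I_n -> 'rV['I_m.+2]_n -> bool) :
    (forall i (x : 'rV_n), x 0 i = ord0 -> ~~ u i x) ->
    (forall i (x : 'rV_n), x 0 i = ord_max -> u i x) ->
  exists x, forall i, exists y z,
    [/\ in_cube x y, in_cube x z, ~~ u i y & u i z].
Proof.
move=> u0 u1.
pose f i x : 'F_2 := (u i x)%:R.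
pose b i x l := seam i x l + d0 (f i) x l.
have closed_b i : closed1 (b i).
  by apply: closed1D; [exact: closed1_seam|exact: closed1_d0].
have b_seam i : cohomologous1 (b i) (seam i) by exists (f i).
have [e he] := cup_prod_cohomologous (enum 'I_n) closed_b (@closed1_seam n m) b_seam.
have /existsP[x nzx] : [exists x, cup_prod [seq b i | i <- enum 'I_n] finset.setT x != 0].
  apply: contraTT (oner_neq0 'F_2) => /existsPn nz.
  rewrite negbK -(sum_cup_prod_seam n m) -[X in X == _]addr0.
  rewrite -[X in _ + X == _](sum_coboundary e [set: 'I_n]) -big_split /=.
  apply/eqP/big1 => x _.
  by rewrite -he; apply/eqP; rewrite -[_ == _]negbK nz.
(* On each of the two faces that bound the seam [u i] is constant, and edges in other
   directions do not cross that seam. *)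
have face i (y : 'rV_n) l : y 0 i = ord0 \/ y 0 i = ord_max -> i != l -> b i y l = 0.
  move=> yi il; rewrite /b /seam /d0 /f eq_sym (negPf il) add0r.
  have yil : (y + unit_step m l) 0 i = y 0 i by rewrite unit_stepE (negPf il) addr0.
  case: yi => yi; last by rewrite !u1 ?yil ?addF2.
  by rewrite !(negPf (u0 _ _ _)) ?yil ?addF2.
have max1 : ord_max + 1 = ord0 :> 'I_m.+2.
  by apply: val_inj; rewrite /= addn1 modnn.
(* If the cube straddled the seam of [i], its vertices would lie on the two faces
   that bound it; on edges across the seam the jump of [u i] from true to false
   cancels the seam cochain. *)
have xmax i : x 0 i != ord_max.
  apply/eqP => xi; have [|A [l [lA]]] := cup_prod_neq0 (i := i) nzx.
    by rewrite mem_enum.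
  set y := x + _; have yi : y 0 i = ord_max + (i \in A)%:R.
    by rewrite mxE sum_unit_step xi.
  have [il|il] := eqVneq i l; last first.
    move/eqP; apply; apply: face => //; rewrite yi.
    by case: (i \in A); [left|right; rewrite addr0].
  move/eqP; apply; rewrite -il in lA *.
  rewrite (negPf lA) addr0 in yi.
  rewrite /b /seam /d0 /f yi !eqxx /= (u1 _ y) //.
  by rewrite (negPf (u0 _ _ _)) ?unit_stepE ?yi ?eqxx ?add0r ?addF2.
(* Off the seams, addition modulo m + 2 does not wrap around. *)
have cube (A : {set 'I_n}) : in_cube x (x + \sum_(j in A) unit_step m j).
  move=> j; rewrite mxE sum_unit_step.
  have xj : ((x 0%R j).+1 < m.+2)%N.
    by rewrite ltn_neqAle ltn_ord andbT; apply: contra_neq (xmax j) => -[xj]; apply: val_inj.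
  case: (j \in A); last by rewrite addr0 leqnn leqnSn.
  by rewrite /= addn1 modn_small ?leqnn ?leqnSn.
exists x => i; have [|A [l [lA]]] := cup_prod_neq0 (i := i) nzx.
  by rewrite mem_enum.
set y := x + _ => bi.
have ey : y + unit_step m l = x + \sum_(j in l |: A) unit_step m j.
  by rewrite big_setU1 //= /y -addrA [X in x + X]addrC.
have cy := cube A; have cz := cube (l |: A); rewrite -ey -/y in cy cz.
have : u i (y + unit_step m l) != u i y.
  apply: contraNneq bi => uy; rewrite /b /d0 /f uy addF2 addr0 /seam.
  have [li|//] := eqVneq l i.
  by rewrite /y mxE sum_unit_step -li (negPf lA) addr0 li (negPf (xmax i)).
case uy : (u i y); case uz : (u i (y + unit_step m l)) => // _.
  by exists (y + unit_step m l), y; rewrite uy uz.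
by exists y, (y + unit_step m l); rewrite uy uz.
Qed.

(** * Nonexpansive maps into the sup-norm space *)

Local Open Scope classical_set_scope.

Lemma mdist_rV_leP (R : realType) n (x y : 'rV[R]_n) (r : R) : 0 <= r ->
  mdist x y <= r <-> forall i, `|x 0 i - y 0 i| <= r.
Proof.
move=> r0; rewrite mdist_rVE; split=> [xy i|xy].
  exact: le_trans (le_bigmax _ (fun i => `|x 0 i - y 0 i|) i) xy.
by apply/Order.TotalTheory.bigmax_leP; split=> // i _; exact: xy.
Qed.

Lemma mdist_rV_coord (R : realType) n (x y : 'rV[R]_n) i :
  `|x 0 i - y 0 i| <= mdist x y.
Proof. exact: (mdist_rV_leP _ _ (mdist_ge0 x y)).1. Qed.

Definition nonexpansive (R : realType) (Y Z : metricType R) (h : Y -> Z) :=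
  forall x y, mdist (h x) (h y) <= mdist x y.

(** The extension is z |-> inf_i (phi i + |z, f i|), the largest 1-Lipschitz
function with the prescribed values. *)
Lemma mcshane_extension (R : realType) (I : Type) (Z : metricType R)
    (f : I -> Z) (phi : I -> R) (i0 : I) :
    (forall i j, `|phi i - phi j| <= mdist (f i) (f j)) ->
  exists h : Z -> R, (forall z w, `|h z - h w| <= mdist z w) /\
                     forall i, h (f i) = phi i.
Proof.
move=> phi_le.
have phiB i j : phi i - phi j <= mdist (f i) (f j).
  exact: le_trans (ler_norm _) (phi_le i j).
pose E z := range (fun i => phi i + mdist z (f i)).
have lbE z : has_lbound (E z).
  exists (phi i0 - mdist z (f i0)) => _ [i _ <-].
  have := phiB i0 i; have := metric_triangle (f i0) z (f i).
  by rewrite [mdist (f i0) z]metric_sym; lra.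
have E0 z : E z !=set0 by exists (phi i0 + mdist z (f i0)); exists i0.
have leE z i : inf (E z) <= phi i + mdist z (f i) by apply: ge_inf => //; exists i.
have infB z w : inf (E z) - inf (E w) <= mdist z w.
  rewrite lerBlDr -lerBlDl; apply: lb_le_inf => // _ [i _ <-].
  by have := leE z i; have := metric_triangle z w (f i); lra.
exists (fun z => inf (E z)); split=> [z w|i].
  by rewrite ler_norml; have := infB z w; have := infB w z; rewrite metric_sym; lra.
apply/eqP; rewrite eq_le; apply/andP; split.
  by have := leE (f i) i; rewrite mdistxx addr0.
by apply: lb_le_inf => // _ [j _ <-]; have := phiB i j; lra.
Qed.

(** Injectivity of the sup-norm space, obtained coordinate by coordinate.  The
family [f] replaces a subset of [Z]. *)
Lemma nonexpansive_extension (R : realType) (I : Type) n (Z : metricType R)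
    (f : I -> Z) (phi : I -> 'rV[R]_n) (i0 : I) :
    (forall i j, mdist (phi i) (phi j) <= mdist (f i) (f j)) ->
  exists h : Z -> 'rV[R]_n, nonexpansive h /\ forall i, h (f i) = phi i.
Proof.
move=> phi_le.
have /choice[h hP] k : exists h : Z -> R,
    (forall z w, `|h z - h w| <= mdist z w) /\ forall i, h (f i) = phi i 0 k.
  apply: mcshane_extension => // i j.
  exact: le_trans (mdist_rV_coord _ _ k) (phi_le i j).
exists (fun z => \row_k h k z); split=> [z w|i].
  apply/mdist_rV_leP; first exact: mdist_ge0.
  by move=> k; rewrite !mxE; exact: (hP k).1.
by apply/rowP => k; rewrite mxE (hP k).2.
Qed.

(** Maps at bounded distance from the identity are onto by degree theory; for a
nonexpansive map the grid theorem already locates near-preimages. *)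
Lemma nonexpansive_near_id_dense (R : realType) n (H : 'rV[R]_n -> 'rV[R]_n)
    (C : R) :
    nonexpansive H -> (forall x, mdist (H x) x <= C) ->
  forall (p : 'rV[R]_n) (e : R), 0 < e -> exists x, mdist (H x) p <= e.
Proof.
move=> H1 HC p e e0.
(* A grid of mesh [e] around [p], extending [k] steps below [p] and [k] + 1 steps
   above: farther out than [H] moves points. *)
pose k := Num.bound (`|C| / e).
have Ck : C < e * k%:R.
  apply: le_lt_trans (ler_norm C) _; rewrite mulrC -ltr_pdivrMr //.
  by rewrite archi_boundP // divr_ge0 // ltW.
pose pt (x : 'rV['I_(k.*2).+2]_n) : 'rV[R]_n :=
  \row_j (p 0 j + e * ((x 0 j)%:R - k%:R)).
pose u i x := p 0 i <= H (pt x) 0 i.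
have Hpt i x : `|H (pt x) 0 i - pt x 0 i| <= C.
  exact: le_trans (mdist_rV_coord _ _ i) (HC _).
have [i x xi|i x xi|x xP] := @cubical_poincare_miranda n k.*2 u.
- rewrite /u -ltNge; have := Hpt i x; rewrite ler_norml mxE xi /=; nra.
- rewrite /u; have := Hpt i x; rewrite ler_norml mxE xi /=.
  by rewrite -[k.*2.+1%:R]natr1 -addnn natrD; nra.
have pt_le y : in_cube x y -> mdist (pt x) (pt y) <= e.
  move=> xy; apply/mdist_rV_leP => [|j]; first exact: ltW.
  have /andP[] := xy j; rewrite !mxE -!(ler_nat R) -[_.+1%:R]natr1.
  by move: (_%:R) (_%:R) => a b ab ba; rewrite ler_norml; nra.
have HB y i : in_cube x y -> `|H (pt x) 0 i - H (pt y) 0 i| <= e.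
  by move=> xy; rewrite (le_trans (mdist_rV_coord _ _ i)) // (le_trans (H1 _ _)) // pt_le.
exists (pt x); apply/mdist_rV_leP => [|i]; first exact: ltW.
have [y [z [xy xz]]] := xP i; rewrite /u -ltNge.
by have := HB y i xy; have := HB z i xz; rewrite !ler_norml; lra.
Qed.

(** * Hausdorff and Gromov-Hausdorff distances *)

Local Open Scope ereal_scope.

Lemma set_dist_ltP (R : realType) (Z : metricType R) (x : Z) (A : set Z) (r : R) :
  set_dist x A < r%:E -> exists2 a, A a & (mdist x a < r)%R.
Proof. by move=> /ereal_inf_lt[_ [a Aa <-]]; rewrite lte_fin; exists a. Qed.

Lemma hausdorff_dist_ltl (R : realType) (Z : metricType R) (A B : set Z) (r : R) a :
  hausdorff_dist A B < r%:E -> A a -> exists2 b, B b & (mdist a b < r)%R.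
Proof.
rewrite /hausdorff_dist gt_max => /andP[Ar _] Aa; apply: set_dist_ltP.
by apply: le_lt_trans Ar; apply: ereal_sup_ubound; exists a.
Qed.

Lemma set_dist_ge0 (R : realType) (Z : metricType R) (x : Z) (A : set Z) :
  0 <= set_dist x A.
Proof.
by apply: le_ereal_inf_tmp => _ [a _ <-]; rewrite lee_fin mdist_ge0.
Qed.

Lemma hausdorff_dist_ge0 (R : realType) (Z : metricType R) (A B : set Z) :
  A !=set0 -> 0 <= hausdorff_dist A B.
Proof.
move=> [a Aa]; rewrite /hausdorff_dist le_max; apply/orP; left.
by apply: le_ereal_sup_tmp; exists (set_dist a B); [exists a|exact: set_dist_ge0].
Qed.

Lemma hausdorff_dist_fin_num (R : realType) (Z : metricType R) (A B : set Z) :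
  A !=set0 -> hausdorff_dist A B < +oo -> hausdorff_dist A B \is a fin_num.
Proof. by move=> A0 ABfin; rewrite ge0_fin_numE // hausdorff_dist_ge0. Qed.

Lemma hausdorff_distC (R : realType) (Z : metricType R) (A B : set Z) :
  hausdorff_dist A B = hausdorff_dist B A.
Proof. exact: maxC. Qed.

Lemma gromov_hausdorff_le_hausdorff (R : realType) (Z : metricType R) (A : set Z) :
  gromov_hausdorff_dist A Z <= hausdorff_dist A [set: Z].
Proof.
apply: ereal_inf_lbound; exists Z, A, [set: Z]; split=> //.
  exists set_val; split=> //; apply/seteqP; split=> [_ [a _ <-]|a Aa].
    exact: set_valP.
  by exists (SigSub (mem_set Aa)).
by exists id; split=> //; rewrite image_id.
Qed.

(** The geometric core of the argument.  That every point is within [C] of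
[X] makes a coarse inverse of v |-> h (g v) available;
the conclusion, obtained from a degree argument, does not depend on [C]. *)
Lemma net_of_isometric_embeddings (R : realType) n (X : set 'rV[R]_n)
    (Z : metricType R) (f : X -> Z) (g : 'rV[R]_n -> Z) (C r : R) :
    (forall x y, mdist (f x) (f y) = mdist x y) ->
    (forall v w, mdist (g v) (g w) = mdist v w) ->
    (forall v, exists2 x, X x & mdist v x <= C)%R ->
    (forall x, exists v, mdist (f x) (g v) <= r)%R ->
    (forall v, exists x, mdist (g v) (f x) <= r)%R ->
  forall (p : 'rV[R]_n) (e : R), (0 < e)%R ->
  exists2 x, X x & (mdist p x <= r + e)%R.
Proof.
move=> fI gI XC fg gf p e e0.
have [x0 Xx0 _] := XC 0%R.
have [h [h1 hf]] : exists h : Z -> 'rV[R]_n,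
    nonexpansive h /\ forall x, h (f x) = set_val x.
  apply: nonexpansive_extension; first exact: (SigSub (mem_set Xx0)).
  by move=> x y; rewrite fI.
(* [g \o k] is a retraction of [Z] onto the image of [g]; extending [k \o f]
   from [X] to all of 'rV_n gives [G], a coarse inverse of [h \o g]. *)
have [k [k1 kg]] : exists k : Z -> 'rV[R]_n,
    nonexpansive k /\ forall v, k (g v) = v.
  by apply: (nonexpansive_extension (phi := id) 0%R) => v w; rewrite gI.
have [G [G1 Gk]] : exists G : 'rV[R]_n -> 'rV[R]_n,
    nonexpansive G /\ forall x : X, G (set_val x) = k (f x).
  apply: nonexpansive_extension; first exact: (SigSub (mem_set Xx0)).
  by move=> x y; rewrite (le_trans (k1 _ _)) // fI.
pose H v := h (g (G v)).
have H1 : nonexpansive H.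
  by move=> v w; rewrite (le_trans (h1 _ _)) // gI G1.
have HX (x : X) : (mdist (H (set_val x)) (set_val x) <= r + r)%R.
  have [v fxv] := fg x.
  have GX : (mdist (G (set_val x)) v <= r)%R.
    by rewrite Gk -{1}(kg v) (le_trans (k1 _ _)).
  rewrite (le_trans (metric_triangle _ (h (g v)) _)) // lerD //.
    by rewrite (le_trans (h1 _ _)) // gI.
  by rewrite -{1}(hf x) (le_trans (h1 _ _)) // metric_sym.
have HC v : (mdist (H v) v <= C + (r + r) + C)%R.
  have [x Xx vx] := XC v; have := HX (SigSub (mem_set Xx)).
  rewrite /= => Hx.
  rewrite (le_trans (metric_triangle _ x _)) // lerD //; last by rewrite metric_sym.
  rewrite (le_trans (metric_triangle _ (H x) _)) // lerD //.
  by rewrite (le_trans (H1 _ _)).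
have [q Hq] := nonexpansive_near_id_dense H1 HC p e0.
have [x gx] := gf (G q); exists (set_val x); first exact: set_valP.
rewrite (le_trans (metric_triangle _ (H q) _)) // addrC lerD //.
  by rewrite -(hf x) (le_trans (h1 _ _)).
by rewrite metric_sym.
Qed.

Theorem theorem1p1 (R : realType) (n : nat) (X : set 'rV[R]_n)
    (X_nonempty : X !=set0)
    (X_finite : hausdorff_dist X [set: 'rV[R]_n] < +oo) :
  gromov_hausdorff_dist (set_type X) 'rV[R]_n
    = hausdorff_dist X [set: 'rV[R]_n].
Proof.
apply/eqP; rewrite eq_le gromov_hausdorff_le_hausdorff /=.
apply: le_ereal_inf_tmp => _ [Z [X' [Y' [[f [fI <-]] [g [gI <-]] ->]]]].
set D := hausdorff_dist (range f) (range g).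
have [->|Dfin] := eqVneq D +oo; first exact: leey.
have [x0 Xx0] := X_nonempty.
have {}Dfin : D \is a fin_num.
  apply: hausdorff_dist_fin_num; last by rewrite ltey.
  by exists (f (SigSub (mem_set Xx0))); exists (SigSub (mem_set Xx0)).
have [C XC] : exists C : R, hausdorff_dist X [set: 'rV[R]_n] < C%:E.
  exists (fine (hausdorff_dist X [set: 'rV[R]_n]) + 1)%R.
  by rewrite EFinD fineK ?hausdorff_dist_fin_num // lteDl ?hausdorff_dist_fin_num.
apply/lee_addgt0Pr => e e0; rewrite -(fineK Dfin) -EFinD.
have e20 : (0 < e / 2)%R by rewrite divr_gt0.
have De : D < (fine D + e / 2)%:E.
  by rewrite EFinD fineK // lteDl // lte_fin.
have De' : hausdorff_dist (range g) (range f) < (fine D + e / 2)%:E.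
  by rewrite hausdorff_distC.
have net := net_of_isometric_embeddings (C := C) fI gI _ _ _ _ e20.
have D_ge0 : (0 <= fine D + e)%R.
  rewrite addr_ge0 ?(ltW e0) // fine_ge0 // hausdorff_dist_ge0 //.
  by exists (f (SigSub (mem_set Xx0))); exists (SigSub (mem_set Xx0)).
rewrite /hausdorff_dist ge_max; apply/andP; split; apply: ge_ereal_sup => _ [a Aa <-].
  apply: le_trans (_ : 0 <= _); last by rewrite lee_fin.
  by apply: ereal_inf_lbound; exists a => //; rewrite mdistxx.
have [|x|v|x Xx ax] := net (fine D + e / 2)%R _ _ _ a.
- move=> v; rewrite hausdorff_distC in XC.
  by have [//|x Xx /ltW vx] := hausdorff_dist_ltl (a := v) XC; exists x.
- have [|_ [v _ <-] /ltW fv] := hausdorff_dist_ltl (a := f x) De; first by exists x.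
  by exists v.
- have [|_ [x _ <-] /ltW gx] := hausdorff_dist_ltl (a := g v) De'; first by exists v.
  by exists x.
apply: le_trans (_ : (mdist a x)%:E <= _); first by apply: ereal_inf_lbound; exists x.
by rewrite lee_fin (le_trans ax) // -addrA -splitr.
Qed.
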